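(* The Wachspress quadrics $(I_{W_d})_2$ are those elements of $S_2$ which are diagonally supported and vanish on $\mathcal{C}$. The quadrics $Q_k=\Lambda_k\cdot \tau$ for $k=1,\dots,d$ span $(I_{W_d})_2$.
   Context: Let $P_d$ be a convex polygon with $d\ge 4$ vertices $v_1,\dots,v_d$ (indices mod $d$) over a field $\mathbb{K}$ with no three edge lines concurrent. Set ${\bf v}_i=(v_i,1)$, ${\bf n}_i={\bf v}_i\times{\bf v}_{i+1}$, $\alpha_j=|{\bf v}_{j-1}\,{\bf v}_j\,{\bf v}_{j+1}|$, $\ell_j=|{\bf v}_j\,{\bf v}_{j+1}\,{\bf p}|$, $b_i=\alpha_i\prod_{j\ne i-1,i}\ell_j$; $W_d\subseteq\mathbb{P}^{d-1}$ is the closure of the image of $p\mapsto(b_1,\dots,b_d)$ with ideal $I_{W_d}\subseteq S=\mathbb{K}[x_1,\ldots,x_d]$. Let $\tau=\sum_i x_i{\bf v}_i\in S_1^3$, $\mathcal{C}=\mathbb{V}(\tau_1,\tau_2,\tau_3)$ the center of the projection $\tau$, and $\Lambda_k=\frac{x_{k+1}}{\alpha_{k+1}}{\bf n}_{k+1}-\frac{x_k}{\alpha_k}{\bf n}_{k-1}$. A quadric is diagonally supported if it is a linear combination of monomials $x_ix_j$ with $j\notin\{i-1,i,i+1\}$. *)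

(* Defs.v *)
From HB Require Import structures.
From mathcomp Require Import all_boot all_order all_algebra.
From mathcomp Require Import mpoly.
Set Implicit Arguments. Unset Strict Implicit. Unset Printing Implicit Defensive.
Import Order.TTheory GRing.Theory Num.Theory.
Local Open Scope ring_scope.

Section Wachspress.
Variable K : realFieldType.

Definition vec3 := (K * K * K)%type.

Definition hv (p : K * K) : vec3 := (p.1, p.2, 1).

Definition coord3 (a : vec3) (c : 'I_3) : K :=
  match val c with 0%N => a.1.1 | 1%N => a.1.2 | _ => a.2 end.

Definition cross (a b : vec3) : vec3 :=
  (a.1.2 * b.2 - a.2 * b.1.2,
   a.2 * b.1.1 - a.1.1 * b.2,
   a.1.1 * b.1.2 - a.1.2 * b.1.1).

Definition dot3 (a b : vec3) : K := a.1.1 * b.1.1 + a.1.2 * b.1.2 + a.2 * b.2.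

Definition det3 (a b c : vec3) : K := dot3 a (cross b c).

Variable d : nat.
Variable v : 'I_d -> K * K.

Notation nxt := (@ordS d).
Notation prv := (@ord_pred d).

(* n_i = v_i x v_{i+1}  (the edge line through v_i, v_{i+1}) *)
Definition nrm (i : 'I_d) : vec3 := cross (hv (v i)) (hv (v (nxt i))).

Definition alpha (j : 'I_d) : K := det3 (hv (v (prv j))) (hv (v j)) (hv (v (nxt j))).

Definition ell (j : 'I_d) (p : K * K) : K := det3 (hv (v j)) (hv (v (nxt j))) (hv p).

Definition bcoord (p : K * K) (i : 'I_d) : K :=
  alpha i * \prod_(j : 'I_d | (j != prv i) && (j != i)) ell j p.

(* Strict convexity of the polygon v_1 ... v_d (vertices in cyclic order, either
   orientation): every vertex not on edge [v_i, v_{i+1}] lies strictly on the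
   same side of the edge line, the side being the same for all edges. *)
Definition convex_polygon : Prop :=
  exists s : K, (s = 1 \/ s = -1) /\
    forall i j : 'I_d, j != i -> j != nxt i ->
      0 < s * det3 (hv (v i)) (hv (v (nxt i))) (hv (v j)).

(* No three (distinct) edge lines are concurrent (in P^2). *)
Definition no_three_concurrent : Prop :=
  forall i j k : 'I_d, i != j -> j != k -> i != k ->
    det3 (nrm i) (nrm j) (nrm k) != 0.

Definition S := {mpoly K[d]}.

Definition is_quadric (q : S) : Prop := forall m, m \in msupp q -> mdeg m = 2%N.

(* q lies in the ideal I_{W_d} of the closure of the image of p |-> (b_1(p),..,b_d(p)),
   i.e. q vanishes on that image. *)
Definition in_IW (q : S) : Prop := forall p : K * K, q.@[bcoord p] = 0.

Definition diag_supported (q : S) : Prop :=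
  forall m, m \in msupp q ->
    exists i j : 'I_d, m = (U_(i) + U_(j))%MM /\ j != prv i /\ j != i /\ j != nxt i.

Definition tau (c : 'I_3) : S := \sum_(i < d) coord3 (hv (v i)) c *: 'X_i.

Definition vanishes_on_C (q : S) : Prop :=
  forall x : 'I_d -> K, (forall c : 'I_3, (tau c).@[x] = 0) -> q.@[x] = 0.

Definition Lambda (k : 'I_d) (c : 'I_3) : S :=
  (coord3 (nrm (nxt k)) c / alpha (nxt k)) *: 'X_(nxt k)
  - (coord3 (nrm (prv k)) c / alpha k) *: 'X_k.

Definition Qk (k : 'I_d) : S := \sum_(c < 3) Lambda k c * tau c.

End Wachspress.

(* Main.v *)
(** Four vertices of the polygon satisfy one linear relation, so for two nonadjacent
    edges (v_a v_(a+1)) and (v_b v_(b+1)) there is, up to scaling, a unique point D(a,b)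
    of C supported on a, a+1, b, b+1.  A quadric of I_W vanishes at D(a,b): the map b
    vanishes at the intersection of the two edge lines, and D(a,b) is the limit of its
    image along a suitable line through that point.  Restricting to the vertices and the
    edge midpoints shows that such a quadric is diagonally supported.

    Conversely, let q be diagonally supported and vanish at all D(a,b).  Subtracting a
    combination of the Q_k removes all the monomials x_0 x_j, since consecutive
    coefficients of the combination are linked by a recursion that can be solved.  What
    is left is zero: if row a vanishes, then vanishing at D(a,b) for b = a+2, a+3, ...
    kills the coefficients of x_(a+1) x_(b+1) one after the other.  So q is in the span
    of the Q_k.  Both families of quadrics in the statement vanish at all D(a,b), and
    the Q_k lie in both: they vanish on C visibly, and on the image of b because
    tau(b(p)) is parallel to (p, 1). *)
Require Import Defs.
From HB Require Import structures.
From mathcomp Require Import all_boot all_order all_algebra.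
From mathcomp Require Import mpoly.
From mathcomp Require Import ring lra zify.
Import Order.TTheory GRing.Theory Num.Theory.
Local Open Scope ring_scope.

(** * Quadratic forms and their symmetric matrices *)

Section QuadraticForms.
Variables (K : realFieldType) (n : nat).
Implicit Types (q : S K n) (x : 'I_n -> K) (A : 'I_n -> 'I_n -> K) (i j k l : 'I_n).

Lemma mnm_pair_eq i j k l : (U_(i) + U_(j) == U_(k) + U_(l) :> 'X_{1..n})%MM =
  (i == k) && (j == l) || (i == l) && (j == k).
Proof.
apply/eqP/orP => [e | [] /andP[/eqP-> /eqP->] //]; last by rewrite addmC.
have at_ m := congr1 (fun mu : 'X_{1..n} => mu m) e.
have [ik|ik] := eqVneq i k.
  left; apply/eqP; have := at_ j; rewrite ik !mnmDE !mnm1E eqxx.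
  by have [-> //|] := eqVneq l j; lia.
have il : i == l.
  by have := at_ i; rewrite !mnmDE !mnm1E eqxx [k == i]eq_sym [l == i]eq_sym (negbTE ik); lia.
right; rewrite il /=; have := at_ j; rewrite (eqP il) !mnmDE !mnm1E eqxx [k == j]eq_sym.
by have [-> //|] := eqVneq j k; lia.
Qed.

Lemma mdeg2_pair (m : 'X_{1..n}) :
  mdeg m = 2%N -> exists i j, m = (U_(i) + U_(j))%MM.
Proof.
move=> m2; have /forallPn[i mi] : ~~ [forall i, m i == 0%N].
  apply/negP => /forallP m0; have : m = 0%MM by apply/mnmP => i; rewrite (eqP (m0 i)) mnm0E.
  by move=> e; rewrite e mdeg0 in m2.
have le : (U_(i) <= m)%MM by rewrite lep1mP.
have := submK le; set r := (m - _)%MM => e.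
have /eqP : mdeg r = 1%N by move: m2; rewrite -e mdegD mdeg1; lia.
rewrite mdeg_eq1 => /existsP[j /eqP rj].
by exists j, i; rewrite -e rj.
Qed.

(** The symmetric matrix of q: an off-diagonal coefficient is shared by two entries. *)
Definition qmx q i j : K := q@_(U_(i) + U_(j)) / (if i == j then 1 else 2).

Definition qform A x : K := \sum_i \sum_j A i j * (x i * x j).

Lemma qmxC q i j : qmx q i j = qmx q j i.
Proof. by rewrite /qmx addmC eq_sym. Qed.

Lemma qmx_eq0 q i j : (qmx q i j == 0) = (q@_(U_(i) + U_(j)) == 0).
Proof.
rewrite /qmx mulf_eq0 invr_eq0; case: (i == j); first by rewrite oner_eq0 orbF.
by rewrite (pnatr_eq0 K 2) orbF.
Qed.

Lemma sum_delta (F : 'I_n -> K) i : \sum_k F k * (k == i)%:R = F i.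
Proof.
rewrite (bigD1 i) //= eqxx mulr1 big1 ?addr0 // => k /negbTE->.
by rewrite mulr0.
Qed.

Lemma sum_delta2 A k l : \sum_i \sum_j A i j * ((j == l)%:R * (i == k)%:R) = A k l.
Proof.
rewrite -(sum_delta (fun i => A i l)); apply: eq_bigr => i _.
by rewrite -(sum_delta (fun j => A i j)) mulr_suml; apply: eq_bigr => j _; rewrite mulrA.
Qed.

Lemma quadric_expand q : is_quadric q ->
  q = \sum_i \sum_j qmx q i j *: ('X_i * 'X_j).
Proof.
move=> hq; apply/mpolyP => m.
have coefE : (\sum_i \sum_j qmx q i j *: ('X_i * 'X_j) : S K n)@_m =
    \sum_i \sum_j qmx q i j * (U_(i) + U_(j) == m)%MM%:R.
  rewrite raddf_sum; apply: eq_bigr => i _; rewrite raddf_sum; apply: eq_bigr => j _.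
  by rewrite /= mcoeffZ -mpolyXD mcoeffX.
rewrite coefE; have [m2|m2] := eqVneq (mdeg m) 2%N; last first.
  rewrite memN_msupp_eq0; last by apply: contra m2 => /hq->.
  rewrite big1 // => i _; rewrite big1 // => j _.
  by have [e|] := eqVneq; [rewrite -e mdegD !mdeg1 eqxx in m2 | rewrite mulr0].
have [k [l ->]] := mdeg2_pair m m2.
under eq_bigr => i _ do under eq_bigr => j _ do rewrite mnm_pair_eq.
(* For k = l the two ways of matching coincide and count once, hence the factor [(k != l)]. *)
have splitE i j : ((i == k) && (j == l) || (i == l) && (j == k))%:R =
    (j == l)%:R * (i == k)%:R + (k != l)%:R * ((j == k)%:R * (i == l)%:R) :> K.
  have [<-|kl] := eqVneq k l; first by rewrite orbb andbC mul0r addr0 -natrM mulnb.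
  rewrite mul1r -!natrM !mulnb -natrD ![(j == _) && _]andbC; congr (_%:R).
  by have [->|_] := eqVneq i k; rewrite ?(negbTE kl) /= ?orbF ?addn0.
under eq_bigr => i _ do under eq_bigr => j _ do rewrite splitE mulrDr [X in _ + X]mulrCA.
under eq_bigr => i _ do rewrite big_split /= -mulr_sumr.
rewrite big_split /= -mulr_sumr !sum_delta2 /qmx eq_sym addmC.
case: (eqVneq k l) => _ /=; first by rewrite mul0r addr0 divr1.
by field.
Qed.
Lemma quadric_eval q x : is_quadric q -> q.@[x] = qform (qmx q) x.
Proof.
move=> hq; rewrite {1}(quadric_expand q hq) raddf_sum; apply: eq_bigr => i _.
by rewrite raddf_sum; apply: eq_bigr => j _; rewrite /= mevalZ mevalM !mevalXU.
Qed.

Lemma qformD A x (y : 'I_n -> K) : (forall i j, A i j = A j i) ->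
  qform A (fun k => x k + y k) =
  qform A x + qform A y + 2 * \sum_i x i * \sum_j A i j * y j.
Proof.
move=> symA; rewrite /qform mulr2n mulrDl mul1r.
have swap : \sum_i x i * (\sum_j A i j * y j) = \sum_i \sum_j A i j * (y i * x j).
  rewrite exchange_big /=; apply: eq_bigr => i _; rewrite mulr_sumr.
  by apply: eq_bigr => j _; rewrite [in RHS]symA; ring.
rewrite {2}swap -!big_split; apply: eq_bigr => i _.
rewrite mulr_sumr -!big_split /=; apply: eq_bigr => j _; ring.
Qed.

(** Polarisation: evaluate at e_i + e_j. *)
Lemma qform_eq0 A : (forall i j, A i j = A j i) -> (forall x, qform A x = 0) ->
  forall i j, A i j = 0.
Proof.
move=> symA A0 i j; have := A0 (fun k => (k == i)%:R + (k == j)%:R).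
rewrite qformD // !A0 !add0r => /eqP; rewrite mulf_eq0 (pnatr_eq0 K 2) /= => /eqP.
under eq_bigr => k _ do rewrite sum_delta mulrC.
by rewrite sum_delta.
Qed.

Lemma quadric_eval_inj q (r : S K n) : is_quadric q -> is_quadric r ->
  (forall x, q.@[x] = r.@[x]) -> q = r.
Proof.
move=> hq hr e; rewrite (quadric_expand q hq) (quadric_expand r hr).
apply: eq_bigr => i _; apply: eq_bigr => j _; congr (_ *: _).
apply/eqP; rewrite -subr_eq0; apply/eqP.
apply: (qform_eq0 (fun i j => qmx q i j - qmx r i j)) => {i j} [i j | x].
  by rewrite ![qmx _ i j]qmxC.
have := e x; rewrite !quadric_eval // => /eqP; rewrite -subr_eq0 => /eqP <-.
rewrite /qform -sumrB; apply: eq_bigr => i _; rewrite -sumrB.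
by apply: eq_bigr => j _; rewrite mulrBl.
Qed.

Lemma is_quadricP q : reflect (is_quadric q) (q \is 2.-homog).
Proof. exact: dhomogP. Qed.

End QuadraticForms.

Arguments qmx {K n}.
Arguments qform {K n}.

(** * Cyclic neighbours of an index *)

Section CyclicOrder.
Variable d : nat.
Implicit Types i j : 'I_d.

Lemma val_ordS i : (ordS i : nat) = if i.+1 == d then 0%N else i.+1.
Proof.
rewrite /=; have := ltn_ord i; rewrite leq_eqVlt.
by case: eqVneq => [e|_ /= lt]; [rewrite e modnn | rewrite modn_small].
Qed.

Lemma ord_eqE i j : (i == j) = (i == j :> nat).
Proof. by []. Qed.

Lemma eq_ord_pred i j : (j == ord_pred i) = (ordS j == i).
Proof. by rewrite -(inj_eq (@ordS_inj d)) ord_predK. Qed.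

Hypothesis d4 : (4 <= d)%N.

Lemma ordS_neq i : ordS i != i.
Proof. by rewrite ord_eqE val_ordS; have := ltn_ord i; case: ifP => /eqP; lia. Qed.

Lemma ordSS_neq i : ordS (ordS i) != i.
Proof.
rewrite ord_eqE !val_ordS; have := ltn_ord i.
by case: (i.+1 =P d) => ?; case: ifP => /eqP; lia.
Qed.

Lemma ord_pred_neq i : ord_pred i != i.
Proof. by rewrite eq_sym eq_ord_pred ordS_neq. Qed.

Lemma ordS_neq_pred i : ordS i != ord_pred i.
Proof. by rewrite eq_ord_pred ordSS_neq. Qed.

End CyclicOrder.

(** * Edge forms at the vertices, and the matrices of combinations of the Q_k *)

Section Wachspress.
Variables (K : realFieldType) (d : nat) (v : 'I_d -> K * K).
Hypothesis d4 : (4 <= d)%N.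
Local Notation nxt := (@ordS d).
Local Notation prv := (@ord_pred d).
Implicit Types (i j k a b : 'I_d) (A : 'I_d -> 'I_d -> K) (c x : 'I_d -> K).

Definition edge i j : K := dot3 (nrm v i) (hv (v j)).
Local Notation N := edge.

Lemma edgexx i : N i i = 0.
Proof. by rewrite /edge /nrm /dot3 /cross /hv /=; ring. Qed.

Lemma edgexS i : N i (nxt i) = 0.
Proof. by rewrite /edge /nrm /dot3 /cross /hv /=; ring. Qed.

Lemma edge_det i j : N i j = det3 (hv (v i)) (hv (v (nxt i))) (hv (v j)).
Proof. by rewrite /edge /nrm /det3 /dot3 /cross /hv /=; ring. Qed.

Lemma edgeS_alpha i : N (nxt i) i = alpha v (nxt i).
Proof. by rewrite /alpha ordSK edge_det /det3 /dot3 /cross /hv /=; ring. Qed.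

Lemma edge_predx i : N (prv i) i = 0.
Proof. by have := edgexS (prv i); rewrite ord_predK. Qed.

Lemma edge_predS i : N (prv i) (nxt i) = alpha v i.
Proof. by rewrite /alpha edge_det ord_predK. Qed.

(* Cramer's rule; N b (a+1) v_a - N b a v_(a+1) is, up to sign, the point n_a x n_b
   where the two edge lines meet. *)
Lemma edge_dependency a b i :
  N i a * N b (nxt a) - N i (nxt a) * N b a +
  N i b * N a (nxt b) - N i (nxt b) * N a b = 0.
Proof. by rewrite /edge /nrm /dot3 /cross /hv /=; ring. Qed.

(* Half the value at D(a,b) of the diagonally supported quadric with symmetric matrix A. *)
Definition cross_sum A a b : K :=
  A a b * (N b (nxt a) * N a (nxt b)) - A a (nxt b) * (N b (nxt a) * N a b)
  - A (nxt a) b * (N b a * N a (nxt b)) + A (nxt a) (nxt b) * (N b a * N a b).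

(* A (non-symmetric) matrix of the quadratic form sum_k c_k Q_k. *)
Definition Qmx c i j : K := (c (prv i) * N i j - c i * N (prv i) j) / alpha v i.

Hypothesis convex : convex_polygon v.

Lemma edge_sign : exists s : K, forall i j, j != i -> j != nxt i -> 0 < s * N i j.
Proof. by have [s [_ hs]] := convex; exists s => i j ji jSi; rewrite edge_det hs. Qed.

Lemma edge_neq0 i j : j != i -> j != nxt i -> N i j != 0.
Proof.
move=> ji jSi; have [s hs] := edge_sign; apply/eqP => N0.
by have := hs _ _ ji jSi; rewrite N0 mulr0 ltxx.
Qed.

Lemma alpha_neq0 i : alpha v i != 0.
Proof.
rewrite -edge_predS; apply: edge_neq0; rewrite ?ord_predK ?ordS_neq //.
by rewrite eq_ord_pred ordSS_neq.
Qed.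

Lemma Qmxxx c i : Qmx c i i = 0.
Proof. by rewrite /Qmx edgexx edge_predx; ring. Qed.

(** The two entries are -c_i and c_i. *)
Lemma Qmx_adj c i : Qmx c i (nxt i) + Qmx c (nxt i) i = 0.
Proof.
rewrite /Qmx ordSK edgexS edgexx edgeS_alpha edge_predS.
by have := alpha_neq0 i; have := alpha_neq0 (nxt i) => h1 h2; field; apply/andP.
Qed.

(** Row i of [Qmx c] combines the rows i-1 and i of [N], so by [edge_dependency] it annihilates
    D(a,b). Pairing the rows a, a+1, b, b+1 with D(a,b) once more gives the cross sum, as diagonal
    entries vanish and adjacent ones cancel. *)
Lemma Qmx_cross_sum c a b : cross_sum (fun i j => Qmx c i j + Qmx c j i) a b = 0.
Proof.
have row i : Qmx c i a * N b (nxt a) - Qmx c i (nxt a) * N b a +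
    Qmx c i b * N a (nxt b) - Qmx c i (nxt b) * N a b = 0.
  have := edge_dependency a b i; have := edge_dependency a b (prv i).
  rewrite /Qmx; set p := prv i => e1 e2.
  transitivity ((c p * (N i a * N b (nxt a) - N i (nxt a) * N b a + N i b * N a (nxt b) -
    N i (nxt b) * N a b) - c i * (N p a * N b (nxt a) - N p (nxt a) * N b a +
      N p b * N a (nxt b) - N p (nxt b) * N a b)) / alpha v i); first by ring.
  by rewrite e1 e2; ring.
have := row a; have := row b; have := row (nxt a); have := row (nxt b).
have := Qmx_adj c a; have := Qmx_adj c b; rewrite /cross_sum !Qmxxx => /eqP.
rewrite addr_eq0 => /eqP-> /eqP; rewrite addr_eq0 => /eqP-> rb' ra' rb ra.
set lhs := (X in X = 0).
transitivity (N b (nxt a) * 0 - N b a * 0 + N a (nxt b) * 0 - N a b * 0 : K); last by ring.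
rewrite -[in N b (nxt a) * 0]ra -[in N b a * 0]ra' -[in N a (nxt b) * 0]rb -[in N a b * 0]rb'.
by rewrite /lhs; ring.
Qed.

(** * Elimination of a diagonally supported form *)

Section Elimination.
Let i0 : 'I_d := Ordinal (ltn_trans (isT : (0 < 3)%N) d4).
(** Natural-number indices keep the inductions from wrapping around the cycle. *)
Let w (k : nat) : 'I_d := insubd i0 k.

Let wE (k : nat) : (k < d)%N -> w k = k :> nat.
Proof. by move=> kd; rewrite /w val_insubd kd. Qed.

Let w_val i : w i = i.
Proof. exact: val_inj (wE _ (ltn_ord i)). Qed.

Let wS (k : nat) : (k.+1 < d)%N -> nxt (w k) = w k.+1.
Proof.
move=> kd; apply/eqP; rewrite ord_eqE val_ordS.
by rewrite (wE _ (ltnW kd)) (wE _ kd) (ltn_eqF kd).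
Qed.

Let w_eq (k l : nat) : (k < d)%N -> (l < d)%N -> (w k == w l) = (k == l).
Proof. by move=> kd ld; rewrite ord_eqE (wE _ kd) (wE _ ld). Qed.

Section Span.
Variable A : 'I_d -> 'I_d -> K.
Hypothesis symA : forall i j, A i j = A j i.
Hypothesis Axx : forall i, A i i = 0.
Hypothesis AxS : forall i, A i (nxt i) = 0.
Hypothesis A_cross : forall a b, b != a -> b != nxt a -> a != nxt b -> cross_sum A a b = 0.

(** Induction on the row m, then on the distance e from the diagonal. Of the four entries in the
    relation of D(m,b), two lie in row m and one is nearer the diagonal in row m+1; the fourth, at
    (m+1, b+1), survives with a nonzero factor. *)
Lemma cross_zero : (forall j, A i0 j = 0) -> forall i j, A i j = 0.
Proof.
move=> A0.
have upper m : forall e, (m + e < d)%N -> A (w m) (w (m + e)) = 0.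
  elim: m => [|m IHm] e med; first by rewrite -[w 0]/(w i0) w_val A0.
  elim: e med => [|e IHe] med; first by rewrite addn0 Axx.
  case: e => [|e] in IHe med *; first by rewrite addn1 in med *; rewrite -(wS m.+1) ?AxS.
  pose b := (m + e.+2)%N.
  have eb : (m.+1 + e.+1 = b)%N by rewrite /b; lia.
  have eb' : (m.+1 + e.+2 = b.+1)%N by rewrite /b; lia.
  have md : (m.+1 < d)%N by lia.
  have bd : (b.+1 < d)%N by rewrite -eb'.
  have mb : (m.+1 < b)%N by rewrite /b; lia.
  have := A_cross (w m) (w b); rewrite /cross_sum !wS // !w_eq; try lia.
  move=> /(_ ltac:(lia) ltac:(lia) ltac:(lia)).
  have -> : A (w m) (w b) = 0 by rewrite IHm // -/b; lia.
  have -> : A (w m) (w b.+1) = 0 by rewrite /b -addnS IHm // addnS -/b; lia.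
  have -> : A (w m.+1) (w b) = 0 by rewrite -eb IHe // eb; lia.
  rewrite eb' !mul0r !subr0 add0r => /eqP; rewrite mulf_eq0 => /orP[/eqP //|].
  rewrite mulf_eq0 => /orP[] /eqP n0.
    by have := edge_neq0 (w b) (w m); rewrite n0 eqxx wS ?w_eq //; lia.
  by have := edge_neq0 (w m) (w b); rewrite n0 eqxx wS ?w_eq //; lia.
move=> i j; wlog le_ij : i j / (i <= j)%N.
  by move=> H; case: (leqP i j) => [|/ltnW] /H // <-.
by rewrite -(w_val i) -(w_val j) -(subnKC le_ij) upper // subnKC.
Qed.

End Span.

(* Solves the equation at x_0 x_k, for k = 1, 2, ..., for c_k in terms of c_(k-1).
   At k = 1 the division is by N 0 0 = 0, which gives the wanted value 0. *)
Fixpoint elim_coef A (k : nat) : K :=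
  if k is k'.+1 then
    (elim_coef A k' * N (w k) (w 0%N) - 2 * alpha v (w k) * A (w 0%N) (w k)) / N (w k') (w 0%N)
  else 0.

Lemma elim_coefS A (k : nat) : elim_coef A k.+1 =
  (elim_coef A k * N (w k.+1) (w 0%N) - 2 * alpha v (w k.+1) * A (w 0%N) (w k.+1))
  / N (w k) (w 0%N).
Proof. by []. Qed.

Lemma cross_span A : (forall i j, A i j = A j i) -> (forall i, A i i = 0) ->
  (forall i, A i (nxt i) = 0) ->
  (forall a b, b != a -> b != nxt a -> a != nxt b -> cross_sum A a b = 0) ->
  exists c, forall i j, A i j = (Qmx c i j + Qmx c j i) / 2.
Proof.
move=> symA Axx AxS Acr.
pose f := elim_coef A; pose c i := f i; exists c.
have w0 : w 0%N = i0 by exact: (w_val i0).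
pose B i j := A i j - (Qmx c i j + Qmx c j i) / 2.
suff B0 : forall i j, B i j = 0.
  by move=> i j; apply/eqP; rewrite -subr_eq0; apply/eqP/B0.
apply: cross_zero => [i j|i|i|a b h1 h2 h3|j].
- by rewrite /B symA [_ + Qmx _ _ _]addrC.
- by rewrite /B Axx Qmxxx; ring.
- by rewrite /B AxS Qmx_adj; ring.
- transitivity (cross_sum A a b - cross_sum (fun i j => Qmx c i j + Qmx c j i) a b / 2).
    by rewrite /cross_sum /B; ring.
  by rewrite Acr // Qmx_cross_sum; ring.
(* The recursion closes up: v_0 lies on edge d-1 and A has no entry at (0, d-1). With c_0 = 0 this
   makes row 0 of [Qmx c] vanish, so only [Qmx c j i0] contributes at x_0 x_j. *)
have last0 : c (prv i0) = 0.
  rewrite /c /f; have := w_val (prv i0); case e : (prv i0 : nat) => [//|k] wp /=.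
  have -> : w k.+1 = prv i0 by [].
  have -> : N (prv i0) (w 0%N) = 0 by rewrite w0 edge_predx.
  have -> : A (w 0%N) (prv i0) = 0 by have := AxS (prv i0); rewrite ord_predK symA w0.
  by rewrite !mulr0 subrr mul0r.
have := Qmx_adj c i0; have := Qmx_adj c (prv i0); rewrite ord_predK => adjp adjn.
have [->|j0] := eqVneq j i0; first by rewrite /B Axx Qmxxx; ring.
have [->|j1] := eqVneq j (nxt i0); first by rewrite /B AxS adjn; ring.
have [->|jp] := eqVneq j (prv i0).
  by rewrite /B addrC [Qmx c i0 _ + _]addrC adjp; have := AxS (prv i0); rewrite ord_predK symA => ->; ring.
have row0 : Qmx c i0 j = 0 by rewrite /Qmx last0 /c /f /=; ring.
rewrite /B row0 /Qmx.
have Sp : c j = (c (prv j) * N j i0 - 2 * alpha v j * A i0 j) / N (prv j) i0.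
  have vj := val_ordS _ (prv j); rewrite ord_predK in vj.
  have {}vj : j = (prv j).+1 :> nat.
    by case: ifP vj => // _ jj; move: j0; rewrite ord_eqE jj.
  by rewrite /c /f vj elim_coefS -vj !w_val w0.
have n0 : N (prv j) i0 != 0.
  apply: edge_neq0; first by rewrite eq_ord_pred eq_sym.
  by rewrite ord_predK eq_sym.
rewrite Sp; have := alpha_neq0 j => aj; field; exact/andP.
Qed.

End Elimination.

(** * Values of the Q_k, and their vanishing on C and on the image of b *)

Lemma ell_edge j p : ell v j p = dot3 (nrm v j) (hv p).
Proof. by rewrite /ell /nrm /det3 /dot3 /cross /hv /=; ring. Qed.

Lemma tau_eval e x : (tau v e).@[x] = \sum_j coord3 (hv (v j)) e * x j.
Proof. by rewrite raddf_sum; apply: eq_bigr => j _; rewrite /= mevalZ mevalXU. Qed.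

Lemma Qk_eval k x : (Qk v k).@[x] =
  \sum_j (x (nxt k) / alpha v (nxt k) * N (nxt k) j - x k / alpha v k * N (prv k) j) * x j.
Proof.
rewrite raddf_sum /=.
under eq_bigr => e _ do rewrite mevalM mevalB !mevalZ !mevalXU tau_eval mulr_sumr.
rewrite exchange_big /=; apply: eq_bigr => j _.
rewrite !big_ord_recr big_ord0 /= /edge /dot3 /coord3 /=; ring.
Qed.

Lemma sum_Qk_eval c x : (\sum_k c k *: Qk v k).@[x] = qform (Qmx c) x.
Proof.
rewrite raddf_sum /=.
under eq_bigr => k _.
  rewrite mevalZ Qk_eval mulr_sumr.
  under eq_bigr => j _.
    rewrite mulrBl mulrBr.
    over.
  rewrite sumrB.
  over.
rewrite sumrB /qform.
(* x_i occurs in Q_(i-1) and in Q_i; a cyclic shift moves the first kind of term to row i. *)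
pose F i := \sum_j c (prv i) * (x i / alpha v i * N i j * x j).
rewrite [X in X - _](_ : _ = \sum_k F (nxt k)); last first.
  by apply: eq_bigr => k _; rewrite /F ordSK.
have -> : \sum_k F (nxt k) = \sum_k F k by rewrite [RHS](reindex_inj (@ordS_inj d)).
rewrite -sumrB; apply: eq_bigr => i _.
by rewrite /F -sumrB; apply: eq_bigr => j _; rewrite /Qmx; ring.
Qed.

Lemma Qk_quadric k : is_quadric (Qk v k).
Proof.
apply/is_quadricP; apply: rpred_sum => e _; apply: (@dhomogM _ _ _ 1 _ 1).
  by apply: rpredB; apply: rpredZ; rewrite dhomogX; apply/eqP/mdeg1.
by apply: rpred_sum => i _; apply: rpredZ; rewrite dhomogX; apply/eqP/mdeg1.
Qed.

Lemma sum_Qk_quadric c : is_quadric (\sum_k c k *: Qk v k).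
Proof.
by apply/is_quadricP; apply: rpred_sum => k _; apply/rpredZ/is_quadricP/Qk_quadric.
Qed.

Lemma Qk_vanishes_on_C k : vanishes_on_C v (Qk v k).
Proof.
by move=> x tau0; rewrite raddf_sum big1 //= => e _; rewrite mevalM tau0 mulr0.
Qed.

(* Since alpha_i v_i = n_(i-1) x n_i, the summand with index i is
   (n_i . m) \prod_(j != i) ell_j - (n_(i-1) . m) \prod_(j != i-1) ell_j. *)
Lemma bcoord_parallel p (m : vec3 K) :
  \sum_i bcoord v p i * det3 (hv (v i)) (hv p) m = 0.
Proof.
pose F i := dot3 (nrm v i) m * \prod_(j | j != i) ell v j p.
have FE i : bcoord v p i * det3 (hv (v i)) (hv p) m = F i - F (prv i).
  have pi := ord_pred_neq d d4 i.
  rewrite /F /bcoord; set P := \prod_(j | _ && _) _.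
  have -> : \prod_(j | j != i) ell v j p = ell v (prv i) p * P.
    by rewrite (bigD1 (prv i)) //; congr (_ * _); apply: eq_bigl => j; rewrite andbC.
  have -> : \prod_(j | j != prv i) ell v j p = ell v i p * P.
    by rewrite (bigD1 i) // eq_sym.
  rewrite !ell_edge /alpha /nrm ord_predK.
  by rewrite /det3 /dot3 /cross /hv /=; ring.
rewrite (eq_bigr _ (fun i _ => FE i)) sumrB.
by rewrite [X in X - _](reindex_inj (@ord_pred_inj d)) subrr.
Qed.

(** With P the product of the edge forms other than k-1, k, k+1, Lambda_k at b(p) is P times the
    cross product of (p, 1) with m = n_(k+1) x n_(k-1). It is orthogonal to (p, 1), hence to
    tau(b(p)). *)
Lemma Qk_in_IW k : in_IW v (Qk v k).
Proof.
move=> p; rewrite Qk_eval.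
pose P := \prod_(j | [&& j != prv k, j != k & j != nxt k]) ell v j p.
have kS : bcoord v p (nxt k) / alpha v (nxt k) = ell v (prv k) p * P.
  rewrite /bcoord mulrAC mulfV ?alpha_neq0 // mul1r (bigD1 (prv k)) /=; last first.
    by rewrite ordSK ord_pred_neq // eq_sym ordS_neq_pred.
  congr (_ * _); apply: eq_bigl => j; rewrite ordSK.
  by case: (j == prv k); case: (j == k); case: (j == nxt k).
have kk : bcoord v p k / alpha v k = ell v (nxt k) p * P.
  rewrite /bcoord mulrAC mulfV ?alpha_neq0 // mul1r (bigD1 (nxt k)) /=; last first.
    by rewrite ordS_neq_pred // ordS_neq.
  congr (_ * _); apply: eq_bigl => j.
  by case: (j == prv k); case: (j == k); case: (j == nxt k).
pose m := cross (nrm v (nxt k)) (nrm v (prv k)).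
rewrite kS kk; transitivity (P * \sum_i bcoord v p i * det3 (hv (v i)) (hv p) m).
  rewrite mulr_sumr; apply: eq_bigr => j _.
  rewrite !ell_edge /m /edge /det3; move: (nrm v (nxt k)) (nrm v (prv k)) => n n'.
  by rewrite /dot3 /cross /=; ring.
by rewrite bcoord_parallel mulr0.
Qed.

Lemma sum_Qk_in_IW c : in_IW v (\sum_k c k *: Qk v k).
Proof.
by move=> p; rewrite raddf_sum big1 //= => k _; rewrite mevalZ Qk_in_IW mulr0.
Qed.

(** * Points supported on two edges *)

(** Indicators add up when indices coincide; a = b serves for points supported on one edge. *)
Definition two_edges a b (s s' t t' : K) k : K :=
  s * (k == a)%:R + s' * (k == nxt a)%:R + t * (k == b)%:R + t' * (k == nxt b)%:R.

Lemma sum_two_edges a b (s s' t t' : K) (F : 'I_d -> K) :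
  \sum_k F k * two_edges a b s s' t t' k =
  F a * s + F (nxt a) * s' + F b * t + F (nxt b) * t'.
Proof.
rewrite -!(sum_delta K d) !mulr_suml -!big_split /=; apply: eq_bigr => k _.
by rewrite /two_edges; ring.
Qed.

Lemma qformE A x : qform A x = \sum_i (\sum_j A i j * x j) * x i.
Proof.
by apply: eq_bigr => i _; rewrite mulr_suml; apply: eq_bigr => j _; ring.
Qed.

(** A has no terms inside either half, so scaling the halves by s and t only contributes the factor
    s t. *)
Lemma qform_two_edges A a b (s t : K) : (forall i j, A i j = A j i) ->
  (forall i, A i i = 0) -> (forall i, A i (nxt i) = 0) ->
  qform A (two_edges a b (s * N b (nxt a)) (- (s * N b a)) (t * N a (nxt b)) (- (t * N a b)))
  = 2 * (s * t) * cross_sum A a b.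
Proof.
move=> symA Axx AxS; rewrite qformE.
under eq_bigr => i _ do rewrite sum_two_edges.
rewrite sum_two_edges !Axx !AxS ![A (nxt a) a]symA ![A (nxt b) b]symA !AxS.
rewrite ![A b _]symA ![A (nxt b) _]symA /cross_sum; ring.
Qed.

(** Take s = t = 1: D(a,b) is in C because tau sends its two halves to opposite vectors, plus and
    minus n_a x n_b. *)
Lemma C_cross_sum A : (forall i j, A i j = A j i) ->
  (forall i, A i i = 0) -> (forall i, A i (nxt i) = 0) ->
  (forall x, (forall e, (tau v e).@[x] = 0) -> qform A x = 0) ->
  forall a b, cross_sum A a b = 0.
Proof.
move=> symA Axx AxS AC a b.
have := qform_two_edges A a b 1 1 symA Axx AxS; rewrite AC => [/esym/eqP|e].
  by rewrite !mulr1 mulf_eq0 (pnatr_eq0 K 2) => /eqP.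
rewrite tau_eval sum_two_edges /edge /nrm /coord3; case: e => [[|[|e]] _] /=;
  by rewrite /dot3 /cross /hv /=; ring.
Qed.

(** * Restriction to vertices and edge midpoints *)

Lemma bcoord_eq0 p k j : j != prv k -> j != k -> ell v j p = 0 -> bcoord v p k = 0.
Proof. by move=> h1 h2 lj; rewrite /bcoord (bigD1 j) ?h1 //= lj mul0r mulr0. Qed.

(** On edge line i only b_i and b_(i+1) survive, leaving a binary form. At v_i only b_i is nonzero,
    which kills [A i i]; at the midpoint both are nonzero, which kills [A i (nxt i)]. *)
Lemma IW_vertex_edge A : (forall i j, A i j = A j i) ->
  (forall p, qform A (bcoord v p) = 0) -> forall i, A i i = 0 /\ A i (nxt i) = 0.
Proof.
move=> symA AW.
have on_edge i p : ell v i p = 0 -> let s := bcoord v p i in let t := bcoord v p (nxt i) in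
    A i i * s ^+ 2 + 2 * (A i (nxt i) * (s * t)) + A (nxt i) (nxt i) * t ^+ 2 = 0.
  move=> li s t; have b0 k : k != i -> k != nxt i -> bcoord v p k = 0.
    by move=> ki kSi; apply: (bcoord_eq0 _ _ i) => //; rewrite ?eq_ord_pred eq_sym.
  have bE k : bcoord v p k = two_edges i i s t 0 0 k.
    rewrite /two_edges !mul0r !addr0; have [->|ki] := eqVneq k i.
      by rewrite [i == _]eq_sym (negbTE (ordS_neq d d4 i)) mulr1 mulr0 addr0.
    have [->|kSi] := eqVneq k (nxt i).
      by rewrite mulr1 mulr0 add0r.
    by rewrite b0 // !mulr0 addr0.
  rewrite -[RHS](AW p) qformE.
  under eq_bigr => k _.
    rewrite bE; under eq_bigr => j _ do rewrite bE.
    rewrite sum_two_edges.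
    over.
  by rewrite sum_two_edges [A (nxt i) i]symA; ring.
have neq0 i p : (forall j, j != prv i -> j != i -> ell v j p != 0) -> bcoord v p i != 0.
  by move=> h; rewrite mulf_neq0 ?alpha_neq0 //; apply/prodf_neq0 => j /andP[]; apply: h.
have ell_v i j : ell v j (v i) = N j i by rewrite ell_edge.
have Axx i : A i i = 0.
  have := on_edge i (v i); rewrite ell_v edgexx => /(_ erefl) /=.
  have -> : bcoord v (v i) (nxt i) = 0.
    apply: (bcoord_eq0 _ _ (prv i)); rewrite ?ell_v ?edge_predx //.
      by rewrite ordSK ord_pred_neq.
    by rewrite eq_sym ordS_neq_pred.
  rewrite !mulr0 expr0n /= mulr0 !addr0 => /eqP; rewrite mulf_eq0 expf_eq0 /= => /orP[/eqP //|b0].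
  suff : bcoord v (v i) i != 0 by rewrite b0.
  apply: neq0 => j jp ji; rewrite ell_v edge_neq0 // 1?eq_sym //.
  by rewrite -eq_ord_pred.
move=> i; split=> //; have := on_edge i (((v i).1 + (v (nxt i)).1) / 2, ((v i).2 + (v (nxt i)).2) / 2).
set p := (_, _).
have ell_p j : ell v j p = (N j i + N j (nxt i)) / 2.
  by rewrite ell_edge /p /edge /dot3 /hv /=; field.
rewrite ell_p edgexx edgexS => /(_ ltac:(by rewrite addr0 mul0r)) /=; rewrite !Axx !mul0r addr0 add0r.
(* By convexity v_i and v_(i+1) lie weakly on one side of edge line j, and at least one of them
   strictly. *)
have n0 j : j != i -> ell v j p != 0.
  move=> ji; rewrite ell_p mulf_neq0 ?invr_eq0 ?(pnatr_eq0 K 2) //; apply/eqP => e.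
  have [s hs] := edge_sign; have [ij|ij] := eqVneq (nxt j) i.
    have := hs j (nxt i); rewrite -ij ordSS_neq // ordS_neq // => /(_ isT isT).
    by move: e; rewrite -ij edgexS add0r => ->; rewrite mulr0 ltxx.
  have p1 := hs j i; rewrite eq_sym ji eq_sym ij in p1; have {}p1 := p1 isT isT.
  have : s * (N j i + N j (nxt i)) = 0 by rewrite e mulr0.
  have [eqj|nij] := eqVneq j (nxt i); first by rewrite eqj edgexx addr0 => z; rewrite eqj z ltxx in p1.
  have p2 := hs j (nxt i); rewrite eq_sym nij (inj_eq (@ordS_inj d)) eq_sym ji in p2.
  by have {}p2 := p2 isT isT; lra.
have bi : bcoord v p i != 0 by apply: neq0 => j _; apply: n0.
have bSi : bcoord v p (nxt i) != 0.
  by apply: neq0 => j; rewrite ordSK => ji _; apply: n0.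
move=> /eqP; rewrite mulf_eq0 (pnatr_eq0 K 2) mulf_eq0 (mulf_eq0 (bcoord v p i)).
by rewrite (negbTE bi) (negbTE bSi) !orbF => /eqP.
Qed.

(** * The limit at the intersection of two edge lines *)

Lemma poly_eq0_horner (p : {poly K}) : (forall t, p.[t] = 0) -> p = 0.
Proof.
move=> p0; apply: (@roots_geq_poly_eq0 _ p [seq k%:R | k : nat <- iota 0 (size p)]).
- by apply/allP => t _; rewrite /root p0.
- by rewrite map_inj_uniq ?iota_uniq // => m n /eqP; rewrite eqr_nat => /eqP.
- by rewrite size_map size_iota.
Qed.

(* The hypotheses on [m] hold with [u = 1] for [m j = n_j . (n_a x n_b)]; exchanging [a] and
   [b] needs [u = -1]. *)
Lemma edge_pair_prod a b (m : 'I_d -> K) (u : K) :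
  b != prv a -> b != a -> b != nxt a ->
  m (nxt a) = - (u * (N b (nxt a) * alpha v (nxt a))) -> m (prv a) = u * (N b a * alpha v a) ->
  let s := - (u * alpha v a * alpha v (nxt a) *
              \prod_(j | [&& j != prv a, j != a, j != nxt a & j != b]) m j) in
  alpha v a * \prod_(j | (j != prv a) && (j != a) && (j != b)) m j = s * N b (nxt a) /\
  alpha v (nxt a) * \prod_(j | (j != prv (nxt a)) && (j != nxt a) && (j != b)) m j
    = - (s * N b a).
Proof.
move=> bp ba bS mS mp; set P := \prod_(j | _) _.
have -> : \prod_(j | (j != prv a) && (j != a) && (j != b)) m j = m (nxt a) * P.
  rewrite (bigD1 (nxt a)) /=; last by rewrite ordS_neq_pred // ordS_neq //= eq_sym.
  congr (_ * _); apply: eq_bigl => j.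
  by case: (j == prv a); case: (j == a); case: (j == b); case: (j == nxt a).
have -> : \prod_(j | (j != prv (nxt a)) && (j != nxt a) && (j != b)) m j = m (prv a) * P.
  rewrite ordSK (bigD1 (prv a)) /=.
    congr (_ * _); apply: eq_bigl => j.
    by case: (j == prv a); case: (j == a); case: (j == b); case: (j == nxt a).
  by rewrite ord_pred_neq // ![prv a == _]eq_sym ordS_neq_pred.
by rewrite mS mp; split; ring.
Qed.

(* [bcoord] in homogeneous coordinates. *)
Definition hcoord (P : vec3 K) i : K :=
  alpha v i * \prod_(j | (j != prv i) && (j != i)) dot3 (nrm v j) P.

Lemma card_other_edges i : #|[pred j | (j != prv i) && (j != i)]| = d.-2.
Proof.
have := cardC (pred2 (prv i) i); rewrite card2 ord_pred_neq // card_ord => /(congr1 (subn^~ 2)).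
rewrite addKn subn2 => <-; apply: eq_card => j; by rewrite !inE negb_or.
Qed.

(** [hcoord] is homogeneous of degree d-2, hence a rescaling of [bcoord] off the line at
    infinity. *)
Lemma qform_hcoord A (P : vec3 K) : (forall p, qform A (bcoord v p) = 0) ->
  P.2 != 0 -> qform A (hcoord P) = 0.
Proof.
move=> AW P2; pose p := (P.1.1 / P.2, P.1.2 / P.2).
have hE i : hcoord P i = P.2 ^+ d.-2 * bcoord v p i.
  rewrite /hcoord /bcoord mulrCA; congr (_ * _).
  rewrite -(card_other_edges i) -prodr_const -big_split; apply: eq_bigr => j _.
  by rewrite ell_edge /dot3 /hv /p /=; field.
transitivity (P.2 ^+ d.-2 ^+ 2 * qform A (bcoord v p)); last by rewrite AW mulr0.
rewrite /qform mulr_sumr; apply: eq_bigr => i _; rewrite mulr_sumr; apply: eq_bigr => j _.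
by rewrite !hE; ring.
Qed.

Hypothesis no3 : no_three_concurrent v.

(* The line [P t] starts at the intersection [Q] of the edge lines, which may be at
   infinity, in the direction of [v_a + v_b]; [hcoord (P t)] is divisible by [t], and the
   quotient [g] at [0] is D(a,b) up to separate scalings of its two halves, which is
   harmless for a diagonally supported quadric. *)
Lemma IW_cross_sum A : (forall i j, A i j = A j i) ->
  (forall p, qform A (bcoord v p) = 0) ->
  forall a b, b != a -> b != nxt a -> a != nxt b -> cross_sum A a b = 0.
Proof.
move=> symA AW a b ba bSa aSb.
have [Axx AxS] : (forall i, A i i = 0) /\ (forall i, A i (nxt i) = 0).
  by split=> i; have [] := IW_vertex_edge A symA AW i.
have bpa : b != prv a by rewrite eq_ord_pred eq_sym.
have apb : a != prv b by rewrite eq_ord_pred eq_sym.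
pose Q := cross (nrm v a) (nrm v b).
pose m j := dot3 (nrm v j) Q; pose r j := N j a + N j b.
have mE j : m j = N b a * N j (nxt a) - N b (nxt a) * N j a.
  rewrite /m /Q /edge /nrm; set n := cross _ (hv (v (nxt j))).
  by rewrite /dot3 /cross /hv /=; ring.
(* Q is a combination of v_a, v_(a+1) and, by the dependency, also of v_b, v_(b+1). *)
have mE' j : m j = N a (nxt b) * N j b - N a b * N j (nxt b).
  have := edge_dependency a b j; rewrite mE => /eqP e.
  by apply/eqP; rewrite -subr_eq0 -oppr_eq0 -(inj_eq (addIr 0)) -(eqP e); apply/eqP; ring.
have ma : m a = 0 by rewrite mE edgexx edgexS; ring.
have mb : m b = 0 by rewrite mE' edgexx edgexS; ring.
have m_neq0 j : j != a -> j != b -> m j != 0.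
  by move=> ja jb; apply: no3; rewrite // eq_sym.
(* An edge form that occurs in component k and vanishes at Q: components a and a+1 omit edge a, so
   they use b. Along the line it equals [r (e k)] times t. *)
pose e k := if (k == a) || (k == nxt a) then b else a.
pose L j : {poly K} := (m j)%:P + (r j)%:P * 'X.
pose J k : pred 'I_d := fun j => (j != prv k) && (j != k) && (j != e k).
pose g k : {poly K} := (alpha v k * r (e k))%:P * \prod_(j | J k j) L j.
pose P t : vec3 K := (Q.1.1 + ((v a).1 + (v b).1) * t, Q.1.2 + ((v a).2 + (v b).2) * t, Q.2 + 2 * t).
have dotP j t : dot3 (nrm v j) (P t) = m j + r j * t.
  by rewrite /m /r /P /edge; move: (nrm v j) => n; rewrite /dot3 /hv /=; ring.
have LE j t : (L j).[t] = m j + r j * t by rewrite /L !hornerE.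
have hE k t : hcoord (P t) k = t * (g k).[t].
  have ek : (e k != prv k) && (e k != k).
    rewrite /e; case: (eqVneq k a) => [->|ka] /=; first by rewrite bpa.
    case: (eqVneq k (nxt a)) => [->|kSa]; first by rewrite ordSK ba.
    by rewrite eq_ord_pred ![_ == k]eq_sym kSa.
  have me : m (e k) = 0 by rewrite /e; case: ifP.
  rewrite /hcoord (bigD1 (e k)) //= dotP me add0r /g !hornerE horner_prod.
  have -> : \prod_(j | J k j) (L j).[t] = \prod_(j | J k j) dot3 (nrm v j) (P t).
    by apply: eq_bigr => j _; rewrite LE dotP.
  by congr (_ * _); rewrite /=; ring.
pose G : {poly K} := \sum_i \sum_j (A i j)%:P * (g i * g j).
have GE t : G.[t] = qform A (fun k => (g k).[t]).
  rewrite /G horner_sum; apply: eq_bigr => i _; rewrite horner_sum; apply: eq_bigr => j _.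
  by rewrite !hornerE.
have G0 : G = 0.
  (* The linear factor is the last coordinate of [P t]; it covers the t at which [P t] is at
     infinity, and is cancelled because its t-coefficient 2 is nonzero. *)
  have : ('X ^+ 2 * ((Q.2)%:P + 2%:P * 'X)) * G = 0.
    apply: poly_eq0_horner => t; rewrite !hornerE GE.
    have [->|Pt] := eqVneq (Q.2 + 2 * t) 0; first by rewrite mulr0 mul0r.
    have := qform_hcoord A (P t) AW Pt.
    suff -> : qform A (hcoord (P t)) = t ^+ 2 * qform A (fun k => (g k).[t]).
      by move=> z; rewrite mulrAC z mul0r.
    rewrite /qform mulr_sumr; apply: eq_bigr => i _; rewrite mulr_sumr.
    by apply: eq_bigr => j _; rewrite !hE; ring.
  move=> /eqP; rewrite !mulf_eq0 polyX_eq0 /= => /orP[|/eqP //].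
  move=> /eqP/(congr1 (fun p : {poly K} => p`_1)).
  by rewrite coefD coefC coefCM coefX coef0 add0r mulr1 => /eqP; rewrite (pnatr_eq0 K 2).
have := GE 0; rewrite G0 horner0 => /esym.
have gE k : (g k).[0] = r (e k) * (alpha v k * \prod_(j | J k j) m j).
  rewrite /g hornerM hornerC horner_prod [alpha v k * _]mulrC -mulrA; do 2!congr (_ * _).
  by apply: eq_bigr => j _; rewrite LE mulr0 addr0.
have [] := edge_pair_prod a b m 1 bpa ba bSa.
- by rewrite mE edgexx edgeS_alpha; ring.
- by rewrite mE edge_predx edge_predS; ring.
set s := - _; move=> sa sSa.
have [] := edge_pair_prod b a m (-1) apb _ aSb.
- by rewrite eq_sym.
- by rewrite mE' edgexx edgeS_alpha; ring.
- by rewrite mE' edge_predx edge_predS; ring.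
set t := - _; move=> tb tSb.
have s0 : s != 0.
  rewrite oppr_eq0 !mulf_neq0 ?alpha_neq0 ?oner_eq0 //; apply/prodf_neq0 => j /and4P[_ ja _ jb].
  exact: m_neq0.
have t0 : t != 0.
  rewrite oppr_eq0 !mulf_neq0 ?alpha_neq0 ?oppr_eq0 ?oner_eq0 //; apply/prodf_neq0 => j /and4P[_ jb _ ja].
  exact: m_neq0.
have ra : r a = N a b by rewrite /r edgexx add0r.
have rb : r b = N b a by rewrite /r edgexx addr0.
have Nab : N a b != 0 by exact: edge_neq0.
have Nba : N b a != 0 by rewrite edge_neq0 // eq_sym.
have gpt k : (g k).[0] = two_edges a b (N b a * s * N b (nxt a)) (- (N b a * s * N b a))
    (N a b * t * N a (nxt b)) (- (N a b * t * N a b)) k.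
  rewrite gE /two_edges /J /e; have [->|ka] := eqVneq k a.
    rewrite eq_sym (negbTE (ordS_neq _ d4 a)) [a == b]eq_sym (negbTE ba) (negbTE aSb).
    by rewrite /= sa rb; ring.
  have [->|kSa] := eqVneq k (nxt a).
    rewrite [_ == b]eq_sym (negbTE bSa) (inj_eq (@ordS_inj d)) eq_sym (negbTE ba) /=.
    by rewrite sSa rb; ring.
  have [->|kb] := eqVneq k b.
    rewrite eq_sym (negbTE (ordS_neq _ d4 b)) /=.
    by rewrite tb ra; ring.
  have [->|kSb] := eqVneq k (nxt b).
    by rewrite /= tSb ra; ring.
  (* Any other component still contains the form of edge b, zero at Q. *)
  rewrite (bigD1 b) /= ?mb; first by ring.
  by rewrite eq_ord_pred ![_ == k]eq_sym kSb kb ba.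
rewrite (_ : qform A _ = qform A (two_edges a b (N b a * s * N b (nxt a)) (- (N b a * s * N b a))
    (N a b * t * N a (nxt b)) (- (N a b * t * N a b)))); last first.
  by apply: eq_bigr => i _; apply: eq_bigr => j _; rewrite !gpt.
rewrite qform_two_edges // => /eqP; rewrite !mulf_eq0 (pnatr_eq0 K 2).
by rewrite (negbTE s0) (negbTE t0) (negbTE Nab) (negbTE Nba) => /eqP.
Qed.

(** * Spanning by the Q_k *)

Lemma diag_supported_qmx (q : S K d) : is_quadric q ->
  diag_supported q <-> (forall i, qmx q i i = 0 /\ qmx q i (nxt i) = 0).
Proof.
move=> hq; split=> [dq i | A0 m mq].
  have no j : ~~ [&& j != prv i, j != i & j != nxt i] -> qmx q i j = 0.
    move=> adj; apply/eqP; rewrite qmx_eq0; apply: contraNT adj; rewrite -mcoeff_msupp.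
    move=> /dq[k [l [/eqP]]]; rewrite mnm_pair_eq => /orP[] /andP[/eqP-> /eqP->] [lp [lk lS]].
      by rewrite lp lk lS.
    by rewrite eq_ord_pred eq_sym lS eq_sym lk eq_sym -eq_ord_pred lp.
  by split; apply: no; rewrite eqxx ?andbF.
have [i [j mE]] := mdeg2_pair d m (hq m mq); exists i, j; split=> //.
have {mq} : qmx q i j != 0 by rewrite qmx_eq0 -mE -mcoeff_msupp.
move=> q0; split; last split; apply: contraNneq q0 => ->.
- by have [_] := A0 (prv i); rewrite ord_predK qmxC => ->.
- by have [->] := A0 i.
- by have [_ ->] := A0 i.
Qed.

Lemma Qk_span (q : S K d) : is_quadric q -> diag_supported q ->
  (forall a b, b != a -> b != nxt a -> a != nxt b -> cross_sum (qmx q) a b = 0) ->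
  exists c, q = \sum_k c k *: Qk v k.
Proof.
move=> hq /(diag_supported_qmx q hq) dq cq.
have [c cE] := cross_span (qmx q) (qmxC K d q)
  (fun i => proj1 (dq i)) (fun i => proj2 (dq i)) cq.
exists c; apply: quadric_eval_inj => // [|x]; first exact: sum_Qk_quadric.
rewrite quadric_eval // sum_Qk_eval /qform.
(* [Qmx c] and its transpose define the same form, so symmetrising is harmless. *)
have swap : \sum_i \sum_j Qmx c j i * (x i * x j) = \sum_i \sum_j Qmx c i j * (x i * x j).
  rewrite exchange_big; apply: eq_bigr => i _; apply: eq_bigr => j _; ring.
transitivity (2^-1 * (\sum_i \sum_j Qmx c i j * (x i * x j)
    + \sum_i \sum_j Qmx c j i * (x i * x j))); last by rewrite swap; field.
rewrite -big_split mulr_sumr; apply: eq_bigr => i _; rewrite -big_split mulr_sumr.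
by apply: eq_bigr => j _; rewrite cE /=; ring.
Qed.

Lemma IW_diag_cross (q : S K d) : is_quadric q -> in_IW v q -> diag_supported q /\
  (forall a b, b != a -> b != nxt a -> a != nxt b -> cross_sum (qmx q) a b = 0).
Proof.
move=> hq qW; have AW p : qform (qmx q) (bcoord v p) = 0 by rewrite -quadric_eval.
split; last exact: IW_cross_sum (qmxC K d q) AW.
by apply/diag_supported_qmx => //; apply: IW_vertex_edge (qmxC K d q) AW.
Qed.

Lemma C_span (q : S K d) : is_quadric q -> diag_supported q -> vanishes_on_C v q ->
  exists c, q = \sum_k c k *: Qk v k.
Proof.
move=> hq dq qC; apply: Qk_span => // a b _ _ _.
have {}dq := proj1 (diag_supported_qmx q hq) dq.
apply: C_cross_sum => [i j|i|i|x x0]; first exact: qmxC.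
- by case: (dq i).
- by case: (dq i).
- by rewrite -quadric_eval // qC.
Qed.

End Wachspress.

Theorem theorem3p7 (K : realFieldType) (d : nat) (v : 'I_d -> K * K) :
  (4 <= d)%N ->
  convex_polygon v ->
  no_three_concurrent v ->
  (* (I_{W_d})_2 = diagonally supported quadrics vanishing on C *)
  (forall q : S K d, is_quadric q ->
     (in_IW v q <-> diag_supported q /\ vanishes_on_C v q)) /\
  (* the Q_k lie in (I_{W_d})_2 ... *)
  (forall k : 'I_d, is_quadric (Qk v k) /\ in_IW v (Qk v k)) /\
  (* ... and span it *)
  (forall q : S K d, is_quadric q -> in_IW v q ->
     exists c : 'I_d -> K, q = \sum_(k < d) c k *: Qk v k).
Proof.
move=> d4 cvx no3.
have span q : is_quadric q -> in_IW v q -> exists c : 'I_d -> K, q = \sum_(k < d) c k *: Qk v k.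
  by move=> hq qW; have [dq cq] := IW_diag_cross K d v d4 cvx no3 q hq qW; apply: Qk_span.
split; last split=> // [k].
  move=> q hq; split=> [qW|[dq qC]]; last first.
    have [c ->] := C_span K d v d4 cvx q hq dq qC; exact: sum_Qk_in_IW.
  split; first by have [] := IW_diag_cross K d v d4 cvx no3 q hq qW.
  have [c ->] := span q hq qW => x x0; rewrite raddf_sum big1 //= => k _.
  by rewrite mevalZ Qk_vanishes_on_C // mulr0.
by split; [exact: Qk_quadric | exact: Qk_in_IW].
Qed.
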